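(* For each positive integer $M$ there exists a real constant $A_M \geq 1$ (depending only on $M$) such that $$1 \leq K_{m,M} \leq A_M^{M/m} \cdot m^{(M^2-1)/(2m)}, \quad \text{for every integer } m \geq M.$$ Consequently, $$\lim_{m \to \infty} K_{m,M} = 1 \quad \text{for every positive integer } M.$$
   Context: Scalars are complex; $\mathbb{D}$ is the open unit disc in $\mathbb{C}$. For a positive integer $n$ and $\alpha = (\alpha_1,\dots,\alpha_n) \in \mathbb{Z}_{\geq 0}^n$, put $|\alpha| = \alpha_1+\cdots+\alpha_n$, $\operatorname{supp}(\alpha) = \{j : \alpha_j > 0\}$, $w(\alpha) = $ the cardinality of $\operatorname{supp}(\alpha)$, and $z^\alpha = z_1^{\alpha_1}\cdots z_n^{\alpha_n}$ for $z \in \mathbb{C}^n$. A polynomial in $n$ variables is a function $P(z) = \sum_\alpha c_\alpha(P) z^\alpha$ on $\mathbb{C}^n$ with $c_\alpha(P)\in\mathbb{C}$, only finitely many of them nonzero. For a positive integer $m$, $P$ is $m$-homogeneous if $c_\alpha(P) = 0$ whenever $|\alpha| \neq m$; $\mathcal{P}_m^{(n)}$ is the vector space of $m$-homogeneous polynomials in $n$ variables, with norm $\|P\|_\infty = \sup_{z \in \mathbb{D}^n} |P(z)|$. For a positive integer $M$, let $$\mathcal{P}_{m,M}^{(n)} = \{P \in \mathcal{P}_m^{(n)} : c_\alpha(P) = 0 \text{ whenever } w(\alpha) > M\}.$$ For positive integers $m, M$, $K_{m,M}$ denotes the least constant such that $$\Bigl(\sum_\alpha |c_\alpha(P)|^{\frac{2m}{m+1}}\Bigr)^{\frac{m+1}{2m}}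 \leq K_{m,M}\cdot \|P\|_\infty$$ for all positive integers $n$ and every $P \in \mathcal{P}_{m,M}^{(n)}$. *)

(* Defs.v *)
From HB Require Import structures.
From mathcomp Require Import all_boot all_order all_algebra.
From mathcomp Require Import all_classical all_reals all_analysis.
From mathcomp Require Import complex.
(* The notations of mpoly clash with those of mathcomp-analysis. *)
From mathcomp Require Import -(notations) mpoly.

Set Implicit Arguments.
Unset Strict Implicit.
Unset Printing Implicit Defensive.

Import Order.TTheory GRing.Theory Num.Theory.
Import numFieldNormedType.Exports.

Local Open Scope classical_set_scope.
Local Open Scope ring_scope.

Section BohnenblustHille.
Variable R : realType.

(* The modulus of a complex number as an element of R; the norm `|z| of the
   library lives in R[i]. *)
Definition cmod (z : R[i]) : R := ComplexField.Normc.normc z.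

Definition polydisc (n : nat) : set ('I_n -> R[i]) :=
  [set z | forall j, cmod (z j) < 1].

Definition msupport (n : nat) (a : multinom n) : {set 'I_n} :=
  [set j | (0 < a j)%N].

Definition mweight (n : nat) (a : multinom n) : nat := #|msupport a|.

(* The real supremum is meaningful: a polynomial is bounded on the polydisc. *)
Definition mnorm_oo (n : nat) (P : mpoly n R[i]) : R :=
  sup [set cmod (meval z P) | z in @polydisc n].

Definition Pspace (m M n : nat) : set (mpoly n R[i]) :=
  [set P | P \is ishomog1 m mdeg /\
     forall a : multinom n, (M < mweight a)%N -> mcoeff a P = 0].

(* Summing over msupp P loses nothing: for m > 0 the inner exponent is positive,
   so every other coefficient would contribute 0. *)
Definition coef_norm (m n : nat) (P : mpoly n R[i]) : R :=
  (\sum_(a <- msupp P)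
      cmod (mcoeff a P) `^ ((2 * m)%:R / (m + 1)%:R))
    `^ ((m + 1)%:R / (2 * m)%:R).

Definition BH_bound (m M : nat) (C : R) : Prop :=
  forall n : nat, (0 < n)%N -> forall P : mpoly n R[i],
    Pspace m M P -> coef_norm m P <= C * mnorm_oo P.

(* The least constant, as an extended real: it is +oo when no constant is
   admissible, and otherwise (for m, M > 0) the infimum is attained, since
   BH_bound is a family of non-strict inequalities. *)
Definition BHconst (m M : nat) : \bar R :=
  ereal_inf [set C%:E | C in BH_bound m M].

End BohnenblustHille.

(* Main.v *)
(** Let c be the coefficient family of P.  Parseval gives |c|_2 <= |P|, so the
    theorem follows by interpolation from a bound
    sum |c|^(2M/(M+1)) <= A m^(M-1) for |P| <= 1.

    Monomials of weight exactly k are handled by colouring the variables with k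
    colours and averaging over roots of unity, which isolates the part of P with a
    prescribed degree a_l > 0 in each colour l.  Since P has weight at most k, the
    monomials of that part contain exactly one variable of each colour, so after
    taking a_l-th roots it is a multiaffine polynomial in disjoint groups of
    variables, with a constant independent of m in the multilinear
    Bohnenblust-Hille inequality.  There are at most (m+1)^(k-1) degree patterns, and
    a proportion at least k^-k of the colourings separates a given support.  Lower
    weights are reached by an averaging operator that kills the monomials of weight
    k, by induction on k. *)
Require Import Defs.
From HB Require Import structures.
From mathcomp Require Import all_boot all_order all_algebra cyclic separable cyclotomic.
From mathcomp Require Import all_classical all_reals all_analysis.
From mathcomp Require Import complex ring lra zify.
From mathcomp Require Import -(notations) mpoly.
(* Gives the finite-set lemmas precedence over their classical_sets homonyms. *)
From mathcomp Require Import fintype finset.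

Set Implicit Arguments.
Unset Strict Implicit.
Unset Printing Implicit Defensive.

Import Order.TTheory GRing.Theory Num.Theory.
Import numFieldNormedType.Exports.

Local Open Scope ring_scope.

(** * The modulus *)

Section Modulus.
Variable R : realType.
Implicit Types x y z : R[i].

Lemma cmod_ge0 z : 0 <= cmod z. Proof. by case: z => a b; exact: sqrtr_ge0. Qed.

Lemma cmod0 : cmod (0 : R[i]) = 0. Proof. exact: ComplexField.Normc.normc0. Qed.

Lemma cmod1 : cmod (1 : R[i]) = 1. Proof. exact: ComplexField.Normc.normc1. Qed.

Lemma cmodM x y : cmod (x * y) = cmod x * cmod y.
Proof. exact: ComplexField.Normc.normcM. Qed.

Lemma cmodD x y : cmod (x + y) <= cmod x + cmod y.
Proof. exact: le_normcD. Qed.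

Lemma cmodN x : cmod (- x) = cmod x. Proof. exact: normcN. Qed.

Lemma cmodX z n : cmod (z ^+ n) = cmod z ^+ n.
Proof. by elim: n => [|n IH]; rewrite ?cmod1 // !exprS cmodM IH. Qed.

Lemma cmod_eq0 z : (cmod z == 0) = (z == 0).
Proof.
apply/eqP/eqP => [/ComplexField.Normc.eq0_normc //|->]; exact: cmod0.
Qed.

Lemma cmod_prod (I : Type) (r : seq I) (P : pred I) (F : I -> R[i]) :
  cmod (\prod_(i <- r | P i) F i) = \prod_(i <- r | P i) cmod (F i).
Proof. by apply: (big_morph _ cmodM cmod1). Qed.

Lemma cmod_sum (I : Type) (r : seq I) (P : pred I) (F : I -> R[i]) :
  cmod (\sum_(i <- r | P i) F i) <= \sum_(i <- r | P i) cmod (F i).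
Proof.
elim/big_rec2: _ => [|i y x _ h]; first by rewrite cmod0.
by apply: le_trans (cmodD _ _) _; rewrite lerD2l.
Qed.

Lemma cmodC (a : R) : cmod a%:C%C = `|a|.
Proof. by rewrite /cmod /= expr0n /= addr0 sqrtr_sqr. Qed.

Lemma cmod_nat n : cmod (n%:R : R[i]) = n%:R.
Proof. by rewrite -(rmorph_nat (@real_complex_def _ (Phant R))) cmodC normr_nat. Qed.

Lemma cmodV z : cmod z^-1 = (cmod z)^-1.
Proof. exact: ComplexField.Normc.normcV. Qed.

Lemma cmod_sqr z : cmod z ^+ 2 = complex.Re z ^+ 2 + complex.Im z ^+ 2.
Proof. by case: z => a b; rewrite sqr_sqrtr // addr_ge0 ?sqr_ge0. Qed.

Lemma cmod_sqrC z : (cmod z ^+ 2)%:C%C = z * (z^*)%C.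
Proof. by rewrite -sqr_normc rmorphXn. Qed.

Lemma cmod_conj z : cmod (z^*)%C = cmod z.
Proof. by case: z => a b; rewrite /cmod /= sqrrN. Qed.

Lemma exists_phase z : exists2 u, cmod u = 1 & u * z = (cmod z)%:C%C.
Proof.
have [->|z0] := eqVneq z 0.
  by exists 1; rewrite ?cmod1 // mulr0 cmod0.
have nz : cmod z != 0 by rewrite cmod_eq0.
exists ((z^*)%C / (cmod z)%:C%C).
  by rewrite cmodM cmodV cmod_conj cmodC ger0_norm ?cmod_ge0 // divff.
have nzC : (cmod z)%:C%C != 0 :> R[i].
  by apply: contra nz => /eqP /complexI /eqP.
apply: (mulIf nzC); rewrite mulrAC divfK // mulrC -cmod_sqrC expr2.
by rewrite rmorphM.
Qed.

Lemma exists_root_of_unimodular z n :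
  (0 < n)%N -> cmod z = 1 -> exists2 w, cmod w = 1 & w ^+ n = z.
Proof.
move=> n0 z1; have zE : (n.-root z)%C ^+ n = z by exact: rootCK.
exists (n.-root z)%C => //; apply/eqP.
by rewrite -(@eqrXn2 _ n) ?cmod_ge0 // expr1n -cmodX zE z1.
Qed.

(** In characteristic zero [X^n - 1] is separable, so it has [n] distinct roots, and such a family
    contains a primitive one. *)
Lemma exists_prim_root n : (0 < n)%N -> exists z : R[i], n.-primitive_root z.
Proof.
move=> n0; have [s] := closed_field_poly_normal ('X^n - 1 : {poly R[i]}).
rewrite (monicP (monicXnsubC _ n0)) scale1r => Es.
have : has n.-primitive_root s; last by case/hasP => z _ ?; exists z.
apply: has_prim_root => //.
- by apply/allP => z; rewrite -root_prod_XsubC -Es.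
- by rewrite -separable_prod_XsubC -Es separable_Xn_sub_1 // pnatr_eq0 -lt0n.
- by rewrite -ltnS -(size_prod_XsubC s id) -Es size_XnsubC.
Qed.

Lemma cmod_prim_root n (z : R[i]) : (0 < n)%N -> n.-primitive_root z -> cmod z = 1.
Proof.
move=> n0 /prim_expr_order /(congr1 (@cmod R)); rewrite cmodX cmod1 => /eqP.
by rewrite -[X in _ == X](expr1n _ n) eqrXn2 ?cmod_ge0 // => /eqP.
Qed.

End Modulus.

(** * Moments of Walsh polynomials *)

Section Walsh.
Variables (R : realType) (I : finType).
Implicit Types (b : {set I} -> R[i]) (e : {ffun I -> bool}) (S A : {set I}) (j : I).

Definition walsh e S : R[i] := \prod_(j in S) (-1) ^+ e j.

Definition chaos b e : R[i] := \sum_S b S * walsh e S.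

Definition flip j e : {ffun I -> bool} := [ffun i => e i (+) (i == j)].

(** As functions of the signs, neither slice depends on coordinate [j]: [chaos b] is the first plus
    the [j]-th sign times the second. *)
Definition slice0 b j S : R[i] := if j \in S then 0 else b S.

Definition slice1 b j S : R[i] := if j \in S then 0 else b (j |: S).

Lemma sum_setU1 (V : zmodType) j (F : {set I} -> V) :
  \sum_(S : {set I} | j \in S) F S = \sum_(S : {set I} | j \notin S) F (j |: S).
Proof.
rewrite (reindex_onto (fun S => j |: S) (fun S => S :\ j)) => [|S jS]; last first.
  exact: setD1K.
apply: eq_bigl => S; rewrite setU11 /=; apply/eqP/idP => [<-|jS].
  by rewrite setD11.
exact: setU1K.
Qed.

Lemma sum_set_split (V : zmodType) j (F : {set I} -> V) :
  \sum_S F S = \sum_(S : {set I} | j \notin S) F S + \sum_(S : {set I} | j \notin S) F (j |: S).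
Proof. by rewrite (bigID (fun S => j \in S)) /= sum_setU1 addrC. Qed.

Lemma sum_slice0 (V : zmodType) b j (h : {set I} -> R[i] -> V) :
  (forall S, h S 0 = 0) ->
  \sum_S h S (slice0 b j S) = \sum_(S : {set I} | j \notin S) h S (b S).
Proof.
move=> h0; rewrite (bigID (fun S : {set I} => j \in S)) /= big1 ?add0r => [|S jS].
  by apply: eq_bigr => S jS; rewrite /slice0 (negbTE jS).
by rewrite /slice0 jS h0.
Qed.

Lemma sum_slice1 (V : zmodType) b j (h : {set I} -> R[i] -> V) :
  (forall S, h S 0 = 0) ->
  \sum_S h S (slice1 b j S) = \sum_(S : {set I} | j \notin S) h S (b (j |: S)).
Proof.
move=> h0; rewrite (bigID (fun S : {set I} => j \in S)) /= big1 ?add0r => [|S jS].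
  by apply: eq_bigr => S jS; rewrite /slice1 (negbTE jS).
by rewrite /slice1 jS h0.
Qed.

Lemma flipK j : involutive (flip j).
Proof. by move=> e; apply/ffunP => i; rewrite !ffunE addbK. Qed.

Lemma walsh_flip j e S : j \notin S -> walsh (flip j e) S = walsh e S.
Proof.
move=> jS; apply: eq_bigr => i iS; rewrite ffunE.
by case: eqP => [ij|]; [rewrite -ij iS in jS | rewrite addbF].
Qed.

Lemma chaos_slice b j e :
  chaos b e = chaos (slice0 b j) e + (-1) ^+ e j * chaos (slice1 b j) e.
Proof.
rewrite /chaos (sum_set_split j) (@sum_slice0 _ b j (fun S z => z * walsh e S)); last first.
  by move=> S; rewrite mul0r.
rewrite (@sum_slice1 _ b j (fun S z => z * walsh e S)) => [|S]; last by rewrite mul0r.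
congr (_ + _); rewrite mulr_sumr; apply: eq_bigr => S jS.
by rewrite /walsh big_setU1 //= mulrCA.
Qed.

Lemma chaos_flip b j e : (forall S, j \in S -> b S = 0) -> chaos b (flip j e) = chaos b e.
Proof.
move=> b0; apply: eq_bigr => S _; have [jS|jS] := boolP (j \in S).
  by rewrite b0 // !mul0r.
by rewrite walsh_flip.
Qed.

(** Pairing [e] with [flip j e] keeps both slices and reverses the [j]-th sign. *)
Lemma sum_chaos_sym b j (h : R[i] -> R) :
  2 * \sum_e h (chaos b e) =
  \sum_e (h (chaos (slice0 b j) e + chaos (slice1 b j) e)
        + h (chaos (slice0 b j) e - chaos (slice1 b j) e)).
Proof.
rewrite mulr_natl mulr2n {2}(reindex_inj (inv_inj (flipK j))) /= -big_split /=.
apply: eq_bigr => e _; rewrite !(chaos_slice b j) ffunE eqxx addbT.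
rewrite !chaos_flip => [|S jS|S jS]; rewrite ?/slice0 ?/slice1 ?jS //.
by case: (e j); rewrite /= ?expr1 ?expr0 ?mul1r ?mulN1r // addrC.
Qed.

Lemma parallelogram (y z : R[i]) :
  cmod (y + z) ^+ 2 + cmod (y - z) ^+ 2 = 2 * (cmod y ^+ 2 + cmod z ^+ 2).
Proof. by rewrite !cmod_sqr; case: y z => [a b] [c d] /=; ring. Qed.

(** The gap is 8 times the square of the imaginary part of [conj(y) z]. *)
Lemma parallelogram4 (y z : R[i]) :
  cmod (y + z) ^+ 4 + cmod (y - z) ^+ 4 <=
  2 * (cmod y ^+ 4 + 6 * (cmod y ^+ 2 * cmod z ^+ 2) + cmod z ^+ 4).
Proof.
rewrite !(exprM _ 2 2) !cmod_sqr; case: y z => [a b] [c d] /=.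
rewrite -subr_ge0 [X in 0 <= X](_ : _ = 8 * (a * d - b * c) ^+ 2); last by ring.
by rewrite mulr_ge0 ?sqr_ge0.
Qed.

Lemma CauchySchwarz_sum (J : finType) (x y : J -> R) :
  (\sum_i x i * y i) ^+ 2 <= (\sum_i x i ^+ 2) * (\sum_i y i ^+ 2).
Proof.
set X := \sum_i x i ^+ 2; set Y := \sum_i y i ^+ 2; set P := \sum_i _.
have : 0 <= \sum_i (Y * x i - P * y i) ^+ 2 by apply: sumr_ge0 => i _; exact: sqr_ge0.
have -> : \sum_i (Y * x i - P * y i) ^+ 2 = Y * (X * Y - P ^+ 2).
  rewrite (eq_bigr (fun i => Y ^+ 2 * x i ^+ 2 + (- (2 * Y * P)) * (x i * y i)
             + P ^+ 2 * y i ^+ 2)) => [|i _]; last by ring.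
  by rewrite !big_split /= -!mulr_sumr -/X -/Y -/P; ring.
have [Y0 _|Yneq0] := eqVneq Y 0; last first.
  rewrite pmulr_rge0 ?subr_ge0 // lt_neqAle eq_sym Yneq0 /=.
  by apply: sumr_ge0 => i _; exact: sqr_ge0.
rewrite Y0 mulr0 /P big1 ?expr0n // => i _.
move/eqP: Y0; rewrite psumr_eq0 => [/allP /(_ i)|k _]; last exact: sqr_ge0.
by rewrite mem_index_enum sqrf_eq0 => /(_ isT) /eqP ->; rewrite mulr0.
Qed.

Lemma chaos_const b e : (forall S, S != set0 -> b S = 0) -> chaos b e = b set0.
Proof.
move=> b0; rewrite /chaos (bigD1 set0) //= big1 => [|S /b0->]; last by rewrite mul0r.
by rewrite /walsh big_set0 mulr1 addr0.
Qed.

(** Parseval's identity and Bonami's hypercontractive estimate from [L^2] to [L^4], both by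
    splitting off one coordinate at a time. *)
Lemma chaos_moments b :
  let K := #|{ffun I -> bool}|%:R in
  \sum_e cmod (chaos b e) ^+ 2 = K * \sum_S cmod (b S) ^+ 2 /\
  \sum_e cmod (chaos b e) ^+ 4 <= K * (\sum_(S : {set I}) 3 ^+ #|S| * cmod (b S) ^+ 2) ^+ 2.
Proof.
move=> K; pose V (c : {set I} -> R[i]) : R := \sum_(S : {set I}) 3 ^+ #|S| * cmod (c S) ^+ 2.
pose Q (c : {set I} -> R[i]) : R := \sum_S cmod (c S) ^+ 2.
pose dom (c : {set I} -> R[i]) := (\bigcup_(S : {set I} | c S != 0) S)%SET.
have V_ge0 c : 0 <= V c.
  by apply: sumr_ge0 => S _; rewrite mulr_ge0 ?sqr_ge0 ?exprn_ge0.
(* Induction on the number of coordinates that [chaos b] involves; both slices lose [j]. *)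
have [n] := ubnP #|dom b|; elim: n b => // n IH b; rewrite ltnS => lebn.
have [dom0|[j jb]] := set_0Vmem (dom b).
  have b0 S : S != set0 -> b S = 0.
    apply: contraNeq => bS; rewrite -subset0 -dom0; exact: bigcup_sup.
  have cE e : chaos b e = b set0 by exact: chaos_const.
  split; under eq_bigr do rewrite cE.
    rewrite sumr_const -/Q -mulr_natl; congr (_ * _).
    by rewrite (bigD1 set0) //= big1 ?addr0 // => S /b0 ->; rewrite cmod0 expr0n.
  rewrite sumr_const -[leLHS]mulr_natl ler_wpM2l // (bigD1 set0) //=.
  rewrite big1 ?addr0 => [|S /b0 ->]; last by rewrite cmod0 expr0n mulr0.
  by rewrite cards0 expr0 mul1r -exprM.
have sub0 : dom (slice0 b j) \subset dom b :\ j.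
  apply/bigcupsP => S; rewrite /slice0; case: ifPn => [_|jS bS]; first by rewrite eqxx.
  by rewrite subsetD1 jS andbT; exact: bigcup_sup.
have sub1 : dom (slice1 b j) \subset dom b :\ j.
  apply/bigcupsP => S; rewrite /slice1; case: ifPn => [_|jS bS]; first by rewrite eqxx.
  rewrite subsetD1 jS andbT (subset_trans (subsetUr [set j] S)) //.
  exact: (bigcup_sup (j |: S)).
have ltn (c : {set I} -> R[i]) : dom c \subset dom b :\ j -> (#|dom c| < n)%N.
  by move=> /subset_leq_card cb; rewrite (leq_trans _ lebn) // (cardsD1 j (dom b)) jb.
have [E2y E4y] := IH _ (ltn _ sub0); have [E2z E4z] := IH _ (ltn _ sub1).
have Qb : Q b = Q (slice0 b j) + Q (slice1 b j).
  rewrite /Q (@sum_slice0 _ b j (fun _ z => cmod z ^+ 2)) => [|S].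
    by rewrite (@sum_slice1 _ b j (fun _ z => cmod z ^+ 2)) ?(sum_set_split j) // => S;
       rewrite cmod0 expr0n.
  by rewrite cmod0 expr0n.
have Vb : V b = V (slice0 b j) + 3 * V (slice1 b j).
  rewrite /V (@sum_slice0 _ b j (fun S z => 3 ^+ #|S| * cmod z ^+ 2)) => [|S].
    rewrite (@sum_slice1 _ b j (fun S z => 3 ^+ #|S| * cmod z ^+ 2)) => [|S].
      rewrite (sum_set_split j) mulr_sumr; congr (_ + _).
      by apply: eq_bigr => S jS; rewrite cardsU1 jS add1n exprS mulrA.
    by rewrite cmod0 expr0n mulr0.
  by rewrite cmod0 expr0n mulr0.
rewrite -/(V _) -/(Q _) Vb Qb.
rewrite -/(Q (slice0 b j)) -/(V (slice0 b j)) in E2y E4y.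
rewrite -/(Q (slice1 b j)) -/(V (slice1 b j)) in E2z E4z.
split.
  apply: (@mulfI _ 2) => //; rewrite (sum_chaos_sym b j (fun z => cmod z ^+ 2)).
  under eq_bigr do rewrite parallelogram.
  by rewrite -mulr_sumr big_split /= E2y E2z; ring.
rewrite -(ler_pM2l (ltr0n _ 2)).
rewrite (sum_chaos_sym b j (fun z => cmod z ^+ 4)).
apply: le_trans (ler_sum _ (fun e _ => parallelogram4 _ _)) _.
rewrite -mulr_sumr ler_pM2l // !big_split /= -mulr_sumr.
set y := chaos (slice0 b j) in E4y *; set z := chaos (slice1 b j) in E4z *.
have YZ : \sum_e cmod (y e) ^+ 2 * cmod (z e) ^+ 2
    <= K * (V (slice0 b j) * V (slice1 b j)).
  rewrite -ler_sqr ?nnegrE ?mulr_ge0 //; last first.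
    by apply: sumr_ge0 => e _; rewrite mulr_ge0 ?sqr_ge0.
  apply: le_trans (CauchySchwarz_sum _ _) _.
  under eq_bigr do rewrite -exprM; under [X in _ * X]eq_bigr do rewrite -exprM.
  rewrite exprMn [in leRHS]exprMn [in leRHS]expr2 [leRHS]mulrACA.
  by apply: ler_pM => //; apply: sumr_ge0 => e _; rewrite exprn_ge0 ?cmod_ge0.
have := V_ge0 (slice0 b j); have := V_ge0 (slice1 b j).
have K0 : 0 <= K by exact: ler0n.
move: YZ E4y E4z; set v0 := V _; set v1 := V _ => YZ E4y E4z v1_ge0 v0_ge0.
apply: (@le_trans _ _ (K * (v0 ^+ 2 + 6 * (v0 * v1) + v1 ^+ 2))).
  by rewrite !mulrDr; nra.
(* The target [(v0 + 3 * v1) ^+ 2] has the same cross term [6 * (v0 * v1)], which is why each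
   coordinate carries the weight 3. *)
rewrite ler_wpM2l // -subr_ge0 [X in 0 <= X](_ : _ = 8 * v1 ^+ 2); last by ring.
by rewrite mulr_ge0 ?sqr_ge0.
Qed.

(** In degree at most [d] the mean of [|X|^4] is at most [9^d] times the square of the mean of
    [|X|^2], and this prevents a small [L^1] norm. *)
Lemma khinchine_chaos b (d : nat) :
  (forall S, b S != 0 -> (#|S| <= d)%N) ->
  #|{ffun I -> bool}|%:R * Num.sqrt (\sum_S cmod (b S) ^+ 2) <=
  3 ^+ d * \sum_e cmod (chaos b e).
Proof.
move=> bd; have [] := chaos_moments b; set K : R := _%:R; set s2 := \sum_S cmod (b S) ^+ 2 => E2 E4.
have s2_ge0 : 0 <= s2 by apply: sumr_ge0 => S _; exact: sqr_ge0.
have sE : Num.sqrt s2 ^+ 2 = s2 by exact: sqr_sqrtr.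
move: sE; set s := Num.sqrt _ => sE.
have [s0|s_neq0] := eqVneq s 0.
  rewrite s0 mulr0 mulr_ge0 ?exprn_ge0 //.
  by apply: sumr_ge0 => e _; exact: cmod_ge0.
have s_gt0 : 0 < s by rewrite lt_neqAle eq_sym s_neq0 sqrtr_ge0.
pose t : R := 3 ^+ d; have t_gt0 : 0 < t by exact: exprn_gt0.
have E4' : \sum_e cmod (chaos b e) ^+ 4 <= K * (t ^+ 2 * s ^+ 4).
  apply: le_trans E4 _; rewrite ler_wpM2l // (_ : t ^+ 2 * _ = (t * s2) ^+ 2).
    rewrite ler_sqr ?nnegrE ?mulr_ge0 ?exprn_ge0 //.
      rewrite mulr_sumr; apply: ler_sum => S _; have [->|/bd Sd] := eqVneq (b S) 0.
        by rewrite cmod0 expr0n !mulr0.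
      by rewrite ler_wpM2r ?sqr_ge0 // ler_weXn2l // ler1n.
    by apply: sumr_ge0 => S _; rewrite mulr_ge0 ?sqr_ge0 ?exprn_ge0.
  by rewrite exprMn -sE -(exprM s).
(* With r = |X| / (t s), integrate [r >= (3 r^2 - r^4) / 2], i.e. [r (r - 1)^2 (r + 2) >= 0]. *)
have pointwise (x : R) : 0 <= x -> 3 * (t * s) ^+ 2 * x ^+ 2 - x ^+ 4 <= 2 * (t * s) ^+ 3 * x.
  move=> x0; have ts : 0 < t * s by exact: mulr_gt0.
  rewrite -subr_ge0 [X in 0 <= X](_ : _ = x * (x - t * s) ^+ 2 * (x + 2 * (t * s))).
    by rewrite mulr_ge0 ?(mulr_ge0 x0) ?sqr_ge0 // addr_ge0 // (mulr_ge0 (ler0n _ 2)) // ltW.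
  by ring.
have := ler_sum (index_enum _) (fun e (_ : true) => pointwise _ (cmod_ge0 (chaos b e))).
rewrite sumrB -!mulr_sumr E2 -sE => H.
have {}H : K * (2 * (t ^+ 2 * s ^+ 4)) <= 2 * (t * s) ^+ 3 * \sum_e cmod (chaos b e).
  apply: le_trans _ H; rewrite -subr_ge0.
  rewrite [X in 0 <= X](_ : _ = K * (t ^+ 2 * s ^+ 4) - \sum_e cmod (chaos b e) ^+ 4).
    by rewrite subr_ge0.
  by ring.
rewrite -/t -(ler_pM2l (x := 2 * (t ^+ 2 * s ^+ 3))); last first.
  by rewrite mulr_gt0 // mulr_gt0 ?exprn_gt0.
by apply: le_trans (le_trans _ H) _; rewrite le_eqVlt; apply/orP; left; apply/eqP; ring.
Qed.
End Walsh.

(** * The Bohnenblust-Hille inequality for rainbow supports *)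

(* Blei's inequality in AM-GM form: with r_j the square root of the mass of the sets
   containing j, the k + 1 numbers g S ^ 2 / r_j (j in S) and prod_(j in S) r_j have
   product g S ^ (2 k), so the largest one bounds g S ^ (2 k / (k + 1)). *)
Lemma blei_powR_sum_le (R : realType) (I : finType) (g : {set I} -> R) (k : nat) (W : R) :
  (0 < k)%N -> (forall S, 0 <= g S) -> (forall S, g S != 0 -> #|S| = k) ->
  \sum_j Num.sqrt (\sum_(S : {set I} | j \in S) g S ^+ 2) <= W ->
  \sum_S g S `^ ((2 * k)%:R / (k + 1)%:R) <= W + expR W.
Proof.
move=> k0 g0 gk rW.
pose r j := Num.sqrt (\sum_(S : {set I} | j \in S) g S ^+ 2).
have r0 j : 0 <= r j by exact: sqrtr_ge0.
have rE j : r j ^+ 2 = \sum_(S : {set I} | j \in S) g S ^+ 2.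
  by rewrite sqr_sqrtr //; apply: sumr_ge0 => S _; exact: sqr_ge0.
have k1 : (k + 1)%:R != 0 :> R by rewrite pnatr_eq0 addn1.
have pointwise S : g S `^ ((2 * k)%:R / (k + 1)%:R) <=
    \sum_(j in S) g S ^+ 2 / r j + \prod_(j in S) r j.
  have terms_ge0 (A : {pred I}) : 0 <= \sum_(j in A) g S ^+ 2 / r j.
    by apply: sumr_ge0 => j _; rewrite mulr_ge0 ?sqr_ge0 ?invr_ge0.
  have prod_ge0 : 0 <= \prod_(j in S) r j by exact: prodr_ge0.
  have [->|gS] := eqVneq (g S) 0.
    rewrite powR0 ?addr_ge0 ?terms_ge0 //.
      by apply: sumr_ge0 => j _; rewrite expr0n mul0r.
    by rewrite mulf_neq0 ?invr_eq0 // pnatr_eq0 muln_eq0 /= -lt0n.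
  have gS_gt0 : 0 < g S by rewrite lt_neqAle eq_sym gS g0.
  set y := g S `^ _; have y_gt0 : 0 < y by exact: powR_gt0.
  have yE : y ^+ (k + 1) = g S ^+ 2 ^+ k.
    by rewrite -powR_mulrn ?ltW // -powRrM divfK // powR_mulrn ?ltW // exprM.
  (* If [y] exceeded the right-hand side, each [g S ^+ 2] would be at most [y * r j] and the product
     of the [r j] below [y]; multiplying contradicts [yE]. *)
  rewrite leNgt; apply/negP => lt_y; suff : y ^+ (k + 1) < y ^+ (k + 1) by rewrite ltxx.
  rewrite {1}yE addn1 -(gk _ gS) -prodr_const.
  apply: le_lt_trans (_ : _ <= \prod_(j in S) (y * r j)) _.
    apply: ler_prod => j jS; rewrite sqr_ge0 /=.
    have rj : 0 < r j.
      rewrite lt_neqAle eq_sym r0 andbT -sqrf_eq0 rE (bigD1 S) //=.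
      rewrite paddr_eq0 ?sqr_ge0 ?sqrf_eq0 ?(negbTE gS) //.
      by apply: sumr_ge0 => ? _; exact: sqr_ge0.
    rewrite -ler_pdivrMr //; apply: le_trans (ltW lt_y).
    rewrite (bigD1 j) //= -addrA lerDl addr_ge0 //.
    by apply: sumr_ge0 => i _; rewrite mulr_ge0 ?sqr_ge0 ?invr_ge0.
  rewrite big_split /= exprSr -prodr_const ltr_pM2l ?prodr_gt0 //.
  by apply: le_lt_trans lt_y; rewrite lerDr.
apply: le_trans (ler_sum _ (fun S _ => pointwise S)) _.
rewrite big_split /=; apply: lerD.
  apply: le_trans rW.
  rewrite (exchange_big_dep predT) //=; apply: ler_sum => j _.
  rewrite -mulr_suml -/(r j) -rE expr2; have [->|rj] := eqVneq (r j) 0; first by rewrite mul0r mul0r.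
  by rewrite mulfK.
(* Expanding the product of the [r j + 1] gives the products over all sets [S]. *)
apply: (@le_trans _ _ (\prod_j (r j + 1))).
  rewrite bigA_distr /=; apply: ler_sum => S _.
  by rewrite -big_mkcond.
apply: (@le_trans _ _ (expR (\sum_j r j))); last by rewrite ler_expR.
rewrite expR_sum; apply: ler_prod => j _.
by rewrite addr_ge0 //= addrC expR_ge1Dx.
Qed.

Section Rainbow.
Variables (R : realType) (I : finType) (k : nat) (chi : I -> 'I_k).
Variable f : {set I} -> R[i].

Definition rainbow (S : {set I}) := [forall l, #|[set j in S | chi j == l]| == 1%N].

Hypothesis f_rainbow : forall S, f S != 0 -> rainbow S.

Hypothesis f_bounded : forall u : I -> R[i], (forall j, cmod (u j) = 1) ->
  cmod (\sum_S f S * \prod_(j in S) u j) <= 1.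

Lemma rainbow_inj S i j : rainbow S -> i \in S -> j \in S -> chi i = chi j -> i = j.
Proof.
move=> /forallP /(_ (chi j)) /cards1P [x Sx] iS jS ij.
have xP y : y \in S -> chi y = chi j -> y = x.
  by move=> yS yj; apply/set1P; rewrite -Sx inE yS yj eqxx.
by rewrite (xP i) // (xP j).
Qed.

Lemma card_rainbow S : rainbow S -> #|S| = k.
Proof.
move=> Sr; rewrite -sum1_card (partition_big chi predT) //=.
rewrite -[RHS]card_ord -sum1_card; apply: eq_bigr => l _.
by rewrite sum1_card -(eqP (forallP Sr l)); apply: eq_card => j; rewrite !inE.
Qed.

(** The polynomial is linear in the variables of colour [l]. Signs on the other colours and optimal
    phases on colour [l] bound the sum of the moduli of its linear coefficients by 1; Khinchine's
    inequality converts their mean moduli into [L^2] norms. *)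
Lemma sum_sqrt_class l :
  \sum_(j | chi j == l) Num.sqrt (\sum_(S : {set I} | j \in S) cmod (f S) ^+ 2) <= 3 ^+ k.
Proof.
set K : R := #|{ffun I -> bool}|%:R.
have K0 : 0 < K by rewrite ltr0n card_ffun card_bool expn_gt0.
pose X j e := chaos (slice1 f j) e.
have sliceE j : \sum_S cmod (slice1 f j S) ^+ 2 = \sum_(S : {set I} | j \in S) cmod (f S) ^+ 2.
  rewrite (@sum_slice1 _ _ _ f j (fun _ z => cmod z ^+ 2)) => [|S].
    by rewrite sum_setU1.
  by rewrite cmod0 expr0n.
have bound e : \sum_(j | chi j == l) cmod (X j e) <= 1.
  have [u uP] : {u : I -> R[i] & forall j, cmod (u j) = 1 /\ u j * X j e = (cmod (X j e))%:C%C}.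
    by apply: (@choice _ _ (fun j z => cmod z = 1 /\ z * X j e = (cmod (X j e))%:C%C)) => j;
      have [z ? ?] := exists_phase (X j e); exists z.
  pose v j : R[i] := if chi j == l then u j else (-1) ^+ e j.
  have v1 j : cmod (v j) = 1.
    rewrite /v; case: ifP => _; first by have [] := uP j.
    by rewrite cmodX cmodN cmod1 expr1n.
  suff sumE : \sum_S f S * \prod_(j in S) v j = (\sum_(j | chi j == l) cmod (X j e))%:C%C.
    by have := f_bounded v1; rewrite sumE cmodC ger0_norm ?sumr_ge0 // => j _; exact: cmod_ge0.
  rewrite rmorph_sum /=.
  (* A rainbow set has exactly one element of colour [l], so the double sum counts each [S] once. *)
  transitivity (\sum_(j | chi j == l) \sum_(S : {set I} | j \in S) f S * \prod_(i in S) v i).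
    rewrite (exchange_big_dep predT) //=; apply: eq_bigr => S _.
    have [->|/f_rainbow /forallP /(_ l) Sl] := eqVneq (f S) 0.
      by rewrite mul0r big1 // => j _; rewrite mul0r.
    rewrite sumr_const (_ : #|_| = 1%N) // -(eqP Sl).
    by apply: eq_card => j; rewrite !inE andbC.
  apply: eq_bigr => j /eqP jl; rewrite -(uP j).2 sum_setU1 mulr_sumr.
  rewrite [RHS](bigID (fun S : {set I} => j \in S)) /=.
  rewrite [X in _ = X + _]big1 ?add0r => [|S jS]; last by rewrite /slice1 jS mul0r mulr0.
  apply: eq_bigr => S jS; rewrite /slice1 (negbTE jS) big_setU1 //= {1}/v jl eqxx.
  have [->|/f_rainbow jSr] := eqVneq (f (j |: S)) 0; first by rewrite !mul0r mulr0.
  rewrite mulrCA; congr (_ * (_ * _)); apply: eq_bigr => i iS; rewrite /v ifN //.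
  apply: contraNneq jS => il.
  by rewrite -(@rainbow_inj (j |: S) i j) ?setU11 ?setU1r // il.
rewrite -(ler_pM2l K0) mulr_sumr.
apply: (@le_trans _ _ (\sum_(j | chi j == l) 3 ^+ k * \sum_e cmod (X j e))).
  apply: ler_sum => j jl; rewrite -sliceE; apply: khinchine_chaos => S.
  rewrite /slice1; case: ifPn => [|jS]; first by rewrite eqxx.
  by move=> /f_rainbow /card_rainbow <-; rewrite cardsU1 jS leq_addl.
rewrite -mulr_sumr exchange_big mulrC ler_wpM2r ?exprn_ge0 //=.
by apply: le_trans (ler_sum _ (fun e _ => bound e)) _; rewrite sumr_const.
Qed.

(** Blei's inequality with [W = k * 3 ^ k]: each of the [k] colours contributes at most [3 ^ k]. *)
Lemma BH_rainbow : (0 < k)%N ->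
  \sum_S cmod (f S) `^ ((2 * k)%:R / (k + 1)%:R) <= (k * 3 ^ k)%:R + expR (k * 3 ^ k)%:R.
Proof.
move=> k0; set N : R := (k * 3 ^ k)%:R.
apply: blei_powR_sum_le k0 (fun S => cmod_ge0 (f S)) _ _ => [S|].
  by rewrite cmod_eq0 => /f_rainbow /card_rainbow.
rewrite (partition_big chi predT) //=.
apply: le_trans (ler_sum _ (fun l _ => sum_sqrt_class l)) _.
by rewrite sumr_const card_ord -[leLHS]mulr_natl /N natrM natrX.
Qed.
End Rainbow.

(** * Averages over roots of unity *)

Section RootsOfUnity.
Variables (R : realType) (N : nat) (zeta : R[i]).
Hypothesis zeta_prim : N.-primitive_root zeta.

Let N_gt0 : (0 < N)%N. Proof. exact: prim_order_gt0 zeta_prim. Qed.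

Let cmod_zeta : cmod zeta = 1. Proof. exact: cmod_prim_root N_gt0 zeta_prim. Qed.

(** The sum factors into one geometric sum per [l], which vanishes unless [y l = 1]. *)
Lemma sum_exp_unity (J : finType) (y : J -> R[i]) : (forall l, y l ^+ N = 1) ->
  \sum_(w : {ffun J -> 'I_N}) \prod_l y l ^+ w l =
  if [forall l, y l == 1] then (N ^ #|J|)%:R else 0.
Proof.
move=> yN; rewrite -(bigA_distr_bigA (fun l (s : 'I_N) => y l ^+ s)) /=.
have geom l : y l != 1 -> \sum_(s < N) y l ^+ s = 0.
  move=> yl; apply/eqP; rewrite -(mulrI_eq0 _ (mulfI (x := y l - 1) _)) ?subr_eq0 //.
  by rewrite -subrX1 yN subrr.
case: ifPn => [/forallP y1|]; last first.
  by move=> /forallPn [l yl]; rewrite (bigD1 l) //= geom // mul0r.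
under eq_bigr => l _ do under eq_bigr => s _ do rewrite (eqP (y1 l)) expr1n.
by rewrite prodr_const sumr_const card_ord -natrX.
Qed.

Lemma conj_zeta : (zeta^*)%C = zeta^-1.
Proof.
have nz : zeta != 0 by rewrite -cmod_eq0 cmod_zeta oner_eq0.
by apply: (mulfI nz); rewrite -cmod_sqrC cmod_zeta expr1n divff.
Qed.

(** Exponents below [N] are determined exactly and not only modulo [N]; hence the roots of order
    [m + 1] for exponents up to [m]. *)
Lemma zeta_eq (a b : nat) : (a < N)%N -> (b < N)%N ->
  (zeta ^+ a * zeta^-1 ^+ b == 1) = (a == b).
Proof.
move=> aN bN; have nz : zeta ^+ b != 0.
  by rewrite expf_neq0 // -cmod_eq0 cmod_zeta oner_eq0.
by rewrite exprVn (can2_eq (divfK nz) (mulfK nz)) // mul1r (eq_prim_root_expr zeta_prim) !modn_small.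
Qed.

Lemma zeta_pow (a b : nat) : (zeta ^+ a * zeta^-1 ^+ b) ^+ N = 1.
Proof.
by rewrite exprMn exprVn exprVn -!exprM ![(_ * N)%N]mulnC !exprM (prim_expr_order zeta_prim)
  !expr1n invr1 mulr1.
Qed.
End RootsOfUnity.

Section Polynomials.
Variables (R : realType) (m n : nat).
(** Exponents up to [m] suffice in degree [m], so coefficient families live on a finite type. *)
Local Notation mon := {ffun 'I_n -> 'I_m.+1}.
Implicit Types (al be : mon) (c : mon -> R[i]) (z : 'I_n -> R[i]).

Definition monom z al : R[i] := \prod_j z j ^+ al j.

Definition peval c z : R[i] := \sum_al c al * monom z al.

Definition degree al : nat := \sum_j al j.

Definition supp al : {set 'I_n} := [set j | (0 < al j)%N].

(** The polydisc is closed here, so that roots of unity are admissible points. *)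
Definition ball1 c := forall z, (forall j, cmod (z j) <= 1) -> cmod (peval c z) <= 1.

(** On the grid of [(m + 1)]-th roots of unity, distinct monomials with exponents at most [m] are
    orthogonal. *)
Lemma parseval_le c : ball1 c -> \sum_al cmod (c al) ^+ 2 <= 1.
Proof.
move=> cP; have [zeta zP] := @exists_prim_root R m.+1 isT.
have zeta1 : cmod zeta = 1 by exact: cmod_prim_root zP.
pose Z (w : mon) j := zeta ^+ w j.
have NT : (0 : R) < (m.+1 ^ n)%:R by rewrite ltr0n expn_gt0.
have sumE : \sum_w cmod (peval c (Z w)) ^+ 2 = (m.+1 ^ n)%:R * \sum_al cmod (c al) ^+ 2.
  apply: complexI; rewrite rmorphM !rmorph_sum /= rmorph_nat.
  transitivity (\sum_(w : mon) \sum_al \sum_be c al * (c be)^*%C *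
      \prod_j (zeta ^+ al j * zeta^-1 ^+ be j) ^+ w j).
    apply: eq_bigr => w _; rewrite cmod_sqrC /peval rmorph_sum /= big_distrlr /=.
    apply: eq_bigr => al _; apply: eq_bigr => be _.
    rewrite rmorphM /= mulrACA; congr (_ * _).
    rewrite /monom rmorph_prod /= -big_split /=; apply: eq_bigr => j _.
    rewrite rmorphXn /= /Z rmorphXn /= (conj_zeta zP).
    by rewrite exprMn -!exprM ![(w j * _)%N]mulnC.
  rewrite exchange_big mulr_sumr; apply: eq_bigr => al _ /=.
  rewrite exchange_big /= (bigD1 al) //= [X in _ + X]big1 ?addr0 => [|be beal].
    rewrite -mulr_sumr sum_exp_unity => [|j]; last exact: zeta_pow.
    rewrite ifT; last by apply/forallP => j; rewrite (zeta_eq zP) ?ltn_ord.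
    by rewrite card_ord cmod_sqrC mulrC.
  rewrite -mulr_sumr sum_exp_unity => [|j]; last exact: zeta_pow.
  rewrite ifF ?mulr0 //; apply: contraNF beal => /forallP H.
  by apply/eqP/ffunP => j; have := H j; rewrite (zeta_eq zP) ?ltn_ord // => /eqP/val_inj.
rewrite -(ler_pM2l NT) -sumE mulr1.
apply: (@le_trans _ _ (\sum_(w : mon) 1)); last by rewrite sumr_const card_ffun !card_ord.
apply: ler_sum => w _; rewrite -[leRHS](expr1n _ 2) ler_sqr ?nnegrE ?cmod_ge0 //.
by apply: cP => j; rewrite cmodX zeta1 expr1n.
Qed.

Lemma coef_le1 c al : ball1 c -> cmod (c al) <= 1.
Proof.
move=> /parseval_le; apply: contraTT; rewrite -!ltNge => c_gt1.
rewrite (bigD1 al) //= ltr_wpDr ?sumr_ge0 // => [be _|]; first exact: sqr_ge0.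
by rewrite -[ltLHS](expr1n _ 2) ltr_sqr ?nnegrE ?cmod_ge0.
Qed.

Variables (k : nat) (chi : 'I_n -> 'I_k).

Definition cdegree al (l : 'I_k) : nat := \sum_(j | chi j == l) al j.

Lemma sum_cdegree al : (\sum_l cdegree al l)%N = degree al.
Proof. by rewrite /degree (partition_big chi predT). Qed.

Lemma cdegree_le al l : (cdegree al l <= degree al)%N.
Proof. by rewrite -sum_cdegree (bigD1 l) //= leq_addr. Qed.

(** Rotating each colour by its own root of unity and averaging against the conjugate character of
    [a] extracts this part as a mean of values of the polynomial. *)
Lemma colour_part_le1 c (a : {ffun 'I_k -> 'I_m.+1}) :
  ball1 c -> (forall al, c al != 0 -> degree al = m) ->
  forall z, (forall j, cmod (z j) <= 1) ->
  cmod (\sum_(al | [forall l, cdegree al l == a l]) c al * monom z al) <= 1.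
Proof.
move=> cP cm z z1; have [zeta zP] := @exists_prim_root R m.+1 isT.
have zeta1 : cmod zeta = 1 by exact: cmod_prim_root zP.
pose Z (w : {ffun 'I_k -> 'I_m.+1}) j := zeta ^+ w (chi j) * z j.
have NT : (0 : R) < (m.+1 ^ k)%:R by rewrite ltr0n expn_gt0.
set Q := \sum_(_ | _) _.
have QE : (m.+1 ^ k)%:R * Q =
    \sum_(w : {ffun 'I_k -> 'I_m.+1}) (\prod_l (zeta^-1 ^+ a l) ^+ w l) * peval c (Z w).
  transitivity (\sum_(w : {ffun 'I_k -> 'I_m.+1}) \sum_al c al * monom z al *
      \prod_l (zeta ^+ cdegree al l * zeta^-1 ^+ a l) ^+ w l); last first.
    apply: eq_bigr => w _; rewrite mulr_sumr; apply: eq_bigr => al _.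
    rewrite [RHS]mulrCA -mulrA; congr (_ * _).
    have -> : monom (Z w) al = monom z al * \prod_l (zeta ^+ cdegree al l) ^+ w l.
      rewrite /monom; under eq_bigr do rewrite exprMn mulrC.
      rewrite big_split /=; congr (_ * _).
      rewrite (partition_big chi predT) //=; apply: eq_bigr => l _.
      rewrite -exprM mulnC exprM -prodrXr.
      by apply: eq_bigr => j /eqP ->.
    by rewrite mulrCA; congr (_ * _); rewrite -big_split /=; apply: eq_bigr => l _;
       rewrite exprMn mulrC.
  rewrite exchange_big /= /Q big_mkcond mulr_sumr /=; apply: eq_bigr => al _.
  rewrite -mulr_sumr; have [->|/cm alm] := eqVneq (c al) 0.
    by rewrite !mul0r; case: ifP; rewrite ?mul0r mulr0.
  rewrite sum_exp_unity => [|j]; last exact: zeta_pow.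
  rewrite (eq_forallb (P2 := fun l => cdegree al l == a l)) => [|l].
    by case: ifP; rewrite ?mulr0 // card_ord mulrC.
  by rewrite (zeta_eq zP) // ltnS (leq_trans (cdegree_le al l)) ?alm.
rewrite -(ler_pM2l NT) mulr1 -[X in X * _]cmod_nat -cmodM QE.
apply: le_trans (cmod_sum _ _ _) _.
apply: (@le_trans _ _ (\sum_(w : {ffun 'I_k -> 'I_m.+1}) 1)); last first.
  by rewrite sumr_const card_ffun !card_ord.
apply: ler_sum => w _; rewrite cmodM cmod_prod big1 ?mul1r => [|l _].
  by apply: cP => j; rewrite cmodM cmodX zeta1 expr1n mul1r.
by rewrite !cmodX cmodV zeta1 invr1 !expr1n.
Qed.
End Polynomials.

(** * Monomials of maximal weight *)

Section ColourClass.
Variables (R : realType) (m n k : nat) (chi : 'I_n -> 'I_k).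
Local Notation mon := {ffun 'I_n -> 'I_m.+1}.
Implicit Types (al : mon) (a : {ffun 'I_k -> 'I_m.+1}) (S : {set 'I_n}).

(** Pigeonhole: all [k] colours occur among at most [k] variables. *)
Lemma rainbow_supp al : (forall l, 0 < cdegree chi al l)%N -> (#|supp al| <= k)%N ->
  rainbow chi (supp al).
Proof.
move=> al_gt0 alk; pose s l := #|[set j in supp al | chi j == l]|.
have s_gt0 l : (0 < s l)%N.
  rewrite lt0n cards_eq0; apply: contraTneq (al_gt0 l) => s0.
  rewrite -eqn0Ngt /cdegree big1 // => j jl.
  by have := in_set0 j; rewrite -s0 !inE jl andbT lt0n => /negbFE/eqP.
have sumE : (\sum_l s l = #|supp al|)%N.
  rewrite -sum1_card (partition_big chi predT) //=; apply: eq_bigr => l _.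
  by rewrite /s -sum1_card; apply: eq_bigl => j; rewrite !inE.
apply/forallP => l; rewrite eqn_leq -/(s l) s_gt0 andbT.
move: sumE; rewrite (bigD1 l) //= => sumE.
rewrite -(leq_add2r (\sum_(i | i != l) s i)) sumE.
apply: leq_trans alk _; rewrite -[leqLHS]card_ord -sum1_card (bigD1 l) //= leq_add2l.
by apply: leq_sum.
Qed.

Lemma cdegree_rainbow al j : rainbow chi (supp al) -> j \in supp al ->
  cdegree chi al (chi j) = al j.
Proof.
move=> alr jal; rewrite /cdegree (bigD1 j) //= big1 ?addn0 // => i /andP[/eqP ij inj].
apply/eqP; rewrite eqn0Ngt; apply: contraNN inj => i0; apply/eqP.
by apply: (rainbow_inj alr) => //; rewrite inE.
Qed.

(** For rainbow [S] and positive [a], the only monomial with support [S] and colour degrees [a]. *)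
Definition pattern a S : mon := [ffun j => if j \in S then a (chi j) else ord0].

Lemma supp_pattern a S : (forall l, 0 < a l)%N -> supp (pattern a S) = S.
Proof.
by move=> a0; apply/setP => j; rewrite inE ffunE; case: ifP; rewrite ?a0.
Qed.

Lemma cdegree_pattern a S l : (forall l, 0 < a l)%N -> rainbow chi S ->
  cdegree chi (pattern a S) l = a l.
Proof.
move=> a0 Sr; have /cards1P [j Sj] := forallP Sr l.
have : j \in [set j in S | chi j == l] by rewrite Sj set11.
rewrite inE => /andP[jS /eqP jl].
by rewrite -[in LHS]jl cdegree_rainbow ?supp_pattern // ffunE jS jl.
Qed.

Lemma pattern_supp a al : rainbow chi (supp al) ->
  [forall l, cdegree chi al l == a l] -> pattern a (supp al) = al.
Proof.
move=> alr /forallP ala; apply/ffunP => j; rewrite ffunE; case: ifPn => jal.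
  by apply: val_inj; rewrite /= -(eqP (ala _)) cdegree_rainbow.
by apply/val_inj/eqP; rewrite /= eq_sym eqn0Ngt; move: jal; rewrite inE.
Qed.

Variable c : mon -> R[i].
Hypothesis c_ball1 : ball1 c.
Hypothesis c_deg : forall al, c al != 0 -> degree al = m.
Hypothesis c_wt : forall al, c al != 0 -> (#|supp al| <= k)%N.

Lemma sum_pattern (V : zmodType) a (F : mon -> V) : (forall l, 0 < a l)%N ->
  \sum_(al | [forall l, cdegree chi al l == a l] && rainbow chi (supp al)) F al =
  \sum_(S | rainbow chi S) F (pattern a S).
Proof.
move=> a0; rewrite (reindex_onto (pattern a) (@supp m n)) => [|al /andP[ala alr]]; last first.
  exact: pattern_supp.
apply: eq_bigl => S; rewrite supp_pattern // eqxx andbT.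
case Sr : (rainbow chi S); rewrite ?andbF // andbT.
by apply/forallP => l; rewrite cdegree_pattern.
Qed.

Definition BHcst : R := (k * 3 ^ k)%:R + expR (k * 3 ^ k)%:R.

Lemma BHcst_ge0 : 0 <= BHcst.
Proof. by rewrite addr_ge0 ?expR_ge0. Qed.

(** Taking [a l]-th roots of unimodular values makes the part of colour degrees [a] multiaffine with
    the same coefficients, so [BH_rainbow] applies. *)
Lemma pattern_class_le a : (0 < k)%N ->
  \sum_(al | [forall l, cdegree chi al l == a l] && rainbow chi (supp al))
     cmod (c al) `^ ((2 * k)%:R / (k + 1)%:R) <= BHcst.
Proof.
(* If some [a l] is 0 the class is empty, because a rainbow support meets colour [l]. *)
move=> k0; have [/forallP a0|] := boolP [forall l, 0 < a l]%N; last first.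
  move=> /forallPn [l]; rewrite -eqn0Ngt => /eqP al0; rewrite big1 ?BHcst_ge0 // => al.
  move=> /andP[/forallP /(_ l)]; rewrite al0 => /eqP cl0 /forallP /(_ l) /cards1P [j jE].
  have : j \in [set i in supp al | chi i == l] by rewrite jE set11.
  rewrite !inE => /andP[j0 jl]; move: cl0; rewrite /cdegree (bigD1 j) //=.
  by move/eqP; rewrite addn_eq0 eqn0Ngt j0.
rewrite sum_pattern //; pose f S := if rainbow chi S then c (pattern a S) else 0.
have q0 : (2 * k)%:R / (k + 1)%:R != 0 :> R.
  by rewrite mulf_neq0 ?invr_eq0 ?pnatr_eq0 ?muln_eq0 ?addn1 //= -lt0n.
have -> : \sum_(S | rainbow chi S) cmod (c (pattern a S)) `^ ((2 * k)%:R / (k + 1)%:R) =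
    \sum_S cmod (f S) `^ ((2 * k)%:R / (k + 1)%:R).
  rewrite big_mkcond; apply: eq_bigr => S _; rewrite /f; case: ifP => // _.
  by rewrite cmod0 powR0.
apply: (@BH_rainbow _ _ _ chi) => // [S|u u1]; rewrite /f.
  by case: ifP => //; rewrite eqxx.
have [z zP] : {z : 'I_n -> R[i] & forall j, cmod (z j) = 1 /\ z j ^+ a (chi j) = u j}.
  apply: (@choice _ _ (fun j w => cmod w = 1 /\ w ^+ a (chi j) = u j)) => j.
  by have [w ? ?] := exists_root_of_unimodular (a0 (chi j)) (u1 j); exists w.
have z1 j : cmod (z j) <= 1 by rewrite (zP j).1.
have := colour_part_le1 chi a c_ball1 c_deg z1.
rewrite (bigID (fun al => rainbow chi (supp al))) /= sum_pattern //.
(* The remaining terms vanish: positive degree in every colour and weight at most [k] force a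
   rainbow support. *)
rewrite [X in _ + X]big1 ?addr0 => [|al /andP[/forallP ala alr]]; last first.
  have [->|/c_wt alk] := eqVneq (c al) 0; first by rewrite mul0r.
  by rewrite rainbow_supp // in alr => l; rewrite (eqP (ala l)).
congr (cmod _ <= 1); rewrite big_mkcond; apply: eq_bigr => S _.
case: ifP => _; last by rewrite mul0r.
congr (_ * _); rewrite /monom [RHS]big_mkcond; apply: eq_bigr => j _.
by rewrite ffunE; case: ifP => // _; rewrite (zP j).2.
Qed.

(** One colour degree is [m] minus the others; this saves a factor [m + 1] and leads to the power
    [M - 1] of [m]. *)
Lemma card_patterns : (0 < k)%N ->
  (#|[pred a : {ffun 'I_k -> 'I_m.+1} | \sum_l a l == m]| <= m.+1 ^ k.-1)%N.
Proof.
case: k => // k' _; pose g (a : {ffun 'I_k'.+1 -> 'I_m.+1}) := [ffun l => a (lift ord0 l)].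
have g_inj : {in [pred a : {ffun 'I_k'.+1 -> 'I_m.+1} | \sum_l a l == m]%N &, injective g}.
  move=> a b; rewrite !inE !big_ord_recl => /eqP am /eqP bm /ffunP ab.
  have abl l : a (lift ord0 l) = b (lift ord0 l) by have := ab l; rewrite !ffunE.
  apply/ffunP => l; case: (unliftP ord0 l) => [l'|] ->; first exact: abl.
  apply: val_inj; apply/eqP.
  rewrite -(eqn_add2r (\sum_(i < k') a (lift ord0 i))) am -[X in X == _]bm.
  by under [X in _ == (_ + X)%N]eq_bigr => i _ do rewrite abl.
rewrite -(card_in_imset g_inj) (leq_trans (max_card _)) //.
by rewrite card_ffun !card_ord.
Qed.

Lemma rainbow_sum_le : (0 < k)%N ->
  \sum_(al | rainbow chi (supp al)) cmod (c al) `^ ((2 * k)%:R / (k + 1)%:R)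
  <= (m.+1 ^ k.-1)%:R * BHcst.
Proof.
move=> k0; set q := _ / _.
have q0 : q != 0.
  by rewrite mulf_neq0 ?invr_eq0 ?pnatr_eq0 ?muln_eq0 ?addn1 //= -lt0n.
rewrite (bigID (fun al => degree al == m)) /= [X in _ + X]big1 ?addr0 => [|al /andP[_ alm]].
  (* [inord] is exact in degree [m], since colour degrees are then at most [m]. *)
  pose h al : {ffun 'I_k -> 'I_m.+1} := [ffun l => inord (cdegree chi al l)].
  have hE al l : degree al = m -> h al l = cdegree chi al l :> nat.
    by move=> alm; rewrite ffunE inordK // ltnS -[leqRHS]alm cdegree_le.
  rewrite (partition_big h (fun a => (\sum_l a l == m)%N)) /=; last first.
    move=> al /andP[_ /eqP alm]; rewrite -[X in _ == X]alm -(sum_cdegree chi).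
    by apply/eqP; apply: eq_bigr => l _; rewrite hE.
  apply: (@le_trans _ _ (\sum_(a : {ffun 'I_k -> 'I_m.+1} | (\sum_l a l == m)%N) BHcst)).
    apply: ler_sum => a _; apply: le_trans (pattern_class_le a k0).
    rewrite big_mkcond [leRHS]big_mkcond; apply: ler_sum => al _.
    case: ifP => [/andP[/andP[alr /eqP alm] /eqP <-]|_]; last by case: ifP; rewrite ?powR_ge0.
    by rewrite ifT // alr andbT; apply/forallP => l; rewrite hE.
  rewrite sumr_const -[leLHS]mulr_natl ler_wpM2r ?BHcst_ge0 // ler_nat.
  exact: card_patterns.
by apply/eqP; rewrite powR_eq0 q0 andbT cmod_eq0; apply: contraNT alm => c_al; apply/eqP; exact: c_deg.
Qed.

End ColourClass.

(** Fixing one bijection from [S] to the colours and leaving the other variables free already gives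
    [k ^ (n - k)] rainbow colourings. *)
Lemma card_rainbow_colourings (n k : nat) (S : {set 'I_n}) : (0 < k)%N -> #|S| = k ->
  (k ^ n <= k ^ k * #|[pred chi : {ffun 'I_n -> 'I_k} | rainbow chi S]|)%N.
Proof.
move=> k0 Sk; have [S0|[i0 i0S]] := set_0Vmem S.
  by rewrite S0 cards0 in Sk; rewrite -Sk in k0.
pose h j := cast_ord Sk (enum_rank_in i0S j).
pose F j : pred 'I_k := if j \in S then pred1 (h j) else predT.
apply: (@leq_trans (k ^ k * #|family F|)%N).
  rewrite card_family foldrE big_map big_enum /= -{1}(card_ord n) -prod_nat_const.
  rewrite (bigID (mem S)) /= prod_nat_const Sk leq_mul2l; apply/orP; right.
  rewrite [leqRHS](bigID (mem S)) /= [X in (_ <= X * _)%N]big1 ?mul1n => [|j jS]; last by rewrite /F jS card1.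
  by apply: leq_prod => j jS; rewrite /F (negbTE jS) card_ord.
rewrite leq_mul2l; apply/orP; right; apply: subset_leq_card.
apply/subsetP => chi /familyP chiF; rewrite inE; apply/forallP => l; apply/cards1P.
have chiE j : j \in S -> chi j = h j by move=> jS; have := chiF j; rewrite /F jS => /eqP.
exists (enum_val (cast_ord (esym Sk) l)); apply/setP => j; rewrite !inE.
have [jS|jS] /= := boolP (j \in S); last first.
  by apply/esym; apply: contraNF jS => /eqP ->; exact: enum_valP.
rewrite chiE // /h; apply/eqP/eqP => [<-|->].
  by rewrite cast_ordK enum_rankK_in.
by rewrite enum_valK_in cast_ordKV.
Qed.

Lemma top_weight_sum_le (R : realType) (m n k : nat) (c : {ffun 'I_n -> 'I_m.+1} -> R[i]) :
  (0 < k)%N -> ball1 c -> (forall al, c al != 0 -> degree al = m) ->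
  (forall al, c al != 0 -> (#|supp al| <= k)%N) ->
  \sum_(al | #|supp al| == k) cmod (c al) `^ ((2 * k)%:R / (k + 1)%:R)
  <= (k ^ k * m.+1 ^ k.-1)%:R * BHcst R k.
Proof.
move=> k0 cP c_deg c_wt; set q := _ / _.
have kn : 0 < (k ^ n)%:R :> R by rewrite ltr0n expn_gt0 k0.
rewrite -(ler_pM2l kn).
(* Double counting: each support of size [k] is rainbow for at least a proportion [k ^ -k] of the
   colourings. *)
apply: (@le_trans _ _ ((k ^ k)%:R * \sum_(chi : {ffun 'I_n -> 'I_k})
    \sum_(al | rainbow chi (supp al)) cmod (c al) `^ q)).
  rewrite (exchange_big_dep (fun al => #|supp al| == k)) /= => [|chi al _ /card_rainbow ->//].
  rewrite !mulr_sumr; apply: ler_sum => al /eqP alk.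
  rewrite sumr_const -[X in _ <= _ * X]mulr_natl mulrA -natrM ler_wpM2r ?powR_ge0 //.
  by rewrite ler_nat card_rainbow_colourings.
rewrite mulrCA natrM -mulrA ler_wpM2l // [leRHS]mulrCA.
have H (chi : {ffun _}) := rainbow_sum_le chi cP c_deg c_wt k0.
apply: le_trans (ler_sum _ (fun chi _ => H chi)) _.
by rewrite sumr_const card_ffun !card_ord -[leLHS]mulr_natl.
Qed.

(** * Lower weights *)

Section WeightReduction.
Variables (R : realType) (m n k : nat).
Local Notation mon := {ffun 'I_n -> 'I_m.+1}.
Variable c : mon -> R[i].

(* A random 0/1 mask multiplies each coefficient by [2 ^- weight] on average, and
   subtracting [2 ^- k] times the polynomial kills the monomials of weight [k]. *)
Definition reduce al : R[i] := (2 ^- #|supp al| - 2 ^- k) / 2 * c al.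

Lemma mask_average (z : 'I_n -> R[i]) :
  \sum_(b : {ffun 'I_n -> bool}) peval c (fun j => (b j)%:R * z j) =
  2 ^+ n * \sum_al 2 ^- #|supp al| * (c al * monom z al).
Proof.
rewrite exchange_big mulr_sumr; apply: eq_bigr => al _ /=.
rewrite -mulr_sumr [2 ^- _ * _]mulrCA [RHS]mulrCA; congr (_ * _).
rewrite (eq_bigr (fun b : {ffun 'I_n -> bool} => monom z al * \prod_j ((b j)%:R : R[i]) ^+ al j)) => [|b _].
  2: by rewrite mulrC -big_split; apply: eq_bigr => j _; rewrite exprMn.
rewrite -mulr_sumr mulrA [RHS]mulrC; congr (_ * _).
rewrite -(bigA_distr_bigA (fun j (x : bool) => x%:R ^+ al j)) /=.
(* Each factor is [1 + 0 ^ al j]: it is 1 on the support and 2 off it, as [0 ^ 0 = 1]. *)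
under eq_bigr => j _ do rewrite big_bool /= expr1n.
rewrite (bigID (mem (supp al))) /= big1 => [|j]; last first.
  by rewrite inE lt0n => j0; rewrite expr0n (negbTE j0) addr0.
rewrite mul1r (eq_bigr (fun _ => 2)) => [|j]; last first.
  by rewrite inE -eqn0Ngt => /eqP ->; rewrite expr0.
have nE : (#|supp al| + #|[predC supp al]|)%N = n by rewrite cardC card_ord.
by rewrite prodr_const -[X in 2 ^+ X / _]nE exprD mulrAC mulfV ?mul1r // expf_neq0 ?pnatr_eq0.
Qed.

(** Masked points stay in the polydisc, so the average [E] is bounded by 1, as is [2 ^- k] times the
    polynomial; the division by 2 in [reduce] absorbs their sum. *)
Lemma reduce_ball1 : ball1 c -> ball1 reduce.
Proof.
move=> cP z z1; set E := \sum_al 2 ^- #|supp al| * (c al * monom z al).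
have E1 : cmod E <= 1.
  have K0 : 0 < 2 ^+ n :> R by exact: exprn_gt0.
  rewrite -(ler_pM2l K0) mulr1 -natrX -[X in X * _]cmod_nat -cmodM natrX -mask_average.
  apply: le_trans (cmod_sum _ _ _) _.
  apply: (@le_trans _ _ (\sum_(b : {ffun 'I_n -> bool}) 1)); last first.
    by rewrite sumr_const card_ffun card_bool card_ord.
  apply: ler_sum => b _; apply: cP => j; rewrite cmodM cmod_nat.
  by case: (b j); rewrite ?mul1r ?mul0r.
have -> : peval reduce z = (E - 2 ^- k * peval c z) / 2.
  rewrite /E /peval mulr_sumr -sumrB mulr_suml; apply: eq_bigr => al _.
  by rewrite /reduce; ring.
rewrite cmodM cmodV (cmod_nat R 2) ler_pdivrMr // mul1r (natrD _ 1 1).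
apply: le_trans (cmodD _ _) _; rewrite cmodN lerD // cmodM cmodV cmodX (cmod_nat R 2).
by rewrite mulr_ile1 ?invr_ge0 ?cmod_ge0 ?exprn_ge0 ?cP // invf_le1 ?exprn_gt0 // exprn_ege1 // ler1n.
Qed.

(** For weight [w < k] the factor in [reduce] is [(2 ^ (k - w) - 1) / 2 ^ (k + 1)], with numerator
    at least 1. *)
Lemma cmod_reduce al : (#|supp al| < k)%N -> cmod (c al) <= 2 ^+ k.+1 * cmod (reduce al).
Proof.
move=> alk; have -> : reduce al = ((2 ^ (k - #|supp al|) - 1)%:R / 2) * 2 ^- k * c al.
  congr (_ * _); rewrite [RHS]mulrAC natrB ?expn_gt0 // (mulrBl (2 ^- k)) mulr1n mul1r natrX; congr ((_ - _) / 2).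
  have kE : 2 ^+ k = 2 ^+ (k - #|supp al|) * 2 ^+ #|supp al| :> R[i].
    by rewrite -exprD subnK // ltnW.
  by rewrite [in RHS]kE invfM mulrA mulfV ?mul1r // expf_neq0 // pnatr_eq0.
rewrite !cmodM cmod_nat !cmodV cmodX (cmod_nat R 2) !mulrA ler_peMl ?cmod_ge0 //.
set t : R := (_ - _)%:R; have t1 : 1 <= t by rewrite ler1n subn_gt0 -{1}(expn0 2) ltn_exp2l ?subn_gt0.
rewrite exprS [X in 1 <= X](_ : _ = t) //.
by field; rewrite expf_neq0 // pnatr_eq0.
Qed.
End WeightReduction.

Lemma powR_weight_bound (R : realType) (M k : nat) : (0 < M)%N -> (k <= M)%N ->
  exists2 A : R, 0 <= A &
    forall (m n : nat) (c : {ffun 'I_n -> 'I_m.+1} -> R[i]),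
      (0 < m)%N -> ball1 c -> (forall al, c al != 0 -> degree al = m) ->
      (forall al, c al != 0 -> (#|supp al| <= k)%N) ->
      \sum_al cmod (c al) `^ ((2 * M)%:R / (M + 1)%:R) <= A * m%:R ^+ M.-1.
Proof.
move=> M0; set p : R := _ / _.
have p0 : 0 < p by rewrite divr_gt0 // ltr0n ?muln_gt0 ?addn1.
elim: k => [_|k IH kM].
  (* Weight 0 and positive degree leave only the zero polynomial. *)
  exists 0 => // m n c m0 _ c_deg c_wt; rewrite mul0r big1 // => al _.
  have [->|cal] := eqVneq (c al) 0; first by rewrite cmod0 powR0 // gt_eqF.
  have := c_wt al cal; rewrite leqn0 cards_eq0 => /eqP al0.
  have := c_deg al cal; rewrite /degree big1 => [m0'|j _]; first by rewrite -m0' in m0.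
  by have := in_set0 j; rewrite -al0 inE lt0n => /negbFE/eqP.
have [A A0 AP] := IH (ltnW kM).
(* The factor [2 ^ M.-1] comes from [(m + 1) ^ k <= (2 * m) ^ (M - 1)], and [2 ^+ k.+2] below from
   [cmod_reduce] at [k.+1]. *)
pose A1 : R := (k.+1 ^ k.+1 * 2 ^ M.-1)%:R * BHcst R k.+1.
exists (A1 + (2 ^+ k.+2) `^ p * A) => [|m n c m0 cP c_deg c_wt].
  by rewrite addr_ge0 ?mulr_ge0 ?powR_ge0 ?BHcst_ge0.
rewrite (bigID (fun al => #|supp al| == k.+1)) /= mulrDl; apply: lerD.
  apply: (@le_trans _ _ ((k.+1 ^ k.+1 * m.+1 ^ k)%:R * BHcst R k.+1)).
    apply: le_trans (top_weight_sum_le (ltn0Sn k) cP c_deg c_wt).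
    apply: ler_sum => al _; set q := _ / _.
    have [->|cal] := eqVneq (c al) 0.
      rewrite cmod0 !powR0 // ?(gt_eqF p0) //.
      by rewrite gt_eqF // divr_gt0 // ltr0n ?muln_gt0 ?addn1.
    (* The moduli are at most 1 and [2k / (k + 1)] increases with [k], so passing to the exponent of
       [M] does not increase the terms. *)
    apply: ger_powR; first by rewrite coef_le1 // lt_neqAle eq_sym cmod_eq0 cal cmod_ge0.
    rewrite /p /q ler_pdivrMr ?ltr0n ?addn1 // mulrAC ler_pdivlMr ?ltr0n //.
    by rewrite -!natrM ler_nat; lia.
  rewrite /A1 mulrAC -natrX -natrM ler_wpM2r ?BHcst_ge0 // ler_nat -mulnA leq_mul2l.
  apply/orP; right; rewrite -expnMn; apply: (@leq_trans ((2 * m) ^ k)).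
    by case: (k) => // k'; rewrite leq_exp2r //; lia.
  by rewrite leq_pexp2l //; lia.
apply: (@le_trans _ _ (\sum_al (2 ^+ k.+2 * cmod (reduce k.+1 c al)) `^ p)).
  rewrite big_mkcond; apply: ler_sum => al _; case: ifP => [alk|_]; last exact: powR_ge0.
  have [->|cal] := eqVneq (c al) 0; first by rewrite cmod0 powR0 ?powR_ge0 // lt0r_neq0.
  apply: ge0_ler_powR; first exact: ltW.
  - exact: cmod_ge0.
  - by rewrite nnegrE mulr_ge0 ?cmod_ge0 ?exprn_ge0.
  - by apply: cmod_reduce; rewrite ltn_neqAle alk c_wt.
under eq_bigr do rewrite powRM ?cmod_ge0 ?exprn_ge0 //.
rewrite -mulr_sumr -mulrA ler_wpM2l ?powR_ge0 //; apply: AP => //.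
- exact: reduce_ball1.
- by move=> al; rewrite mulf_eq0 negb_or => /andP[_ /c_deg].
- move=> al; rewrite mulf_eq0 negb_or => /andP[d0 /c_wt]; rewrite leq_eqVlt ltnS.
  by case/orP => // /eqP alk; rewrite /= alk subrr mul0r eqxx in d0.
Qed.

(** * Interpolation *)

(** Interpolation between the exponents [p] and 2 with weight [s = (M + 1) / (m + 1)] on [p]. The
    exponent 2 costs nothing by Parseval, so [B] enters only to the power [(M + 1) / (2m)]. *)
Lemma BH_ball1 (R : realType) (M : nat) : (0 < M)%N ->
  exists2 A : R, 1 <= A &
    forall (m n : nat) (c : {ffun 'I_n -> 'I_m.+1} -> R[i]),
      (M <= m)%N -> ball1 c -> (forall al, c al != 0 -> degree al = m) ->
      (forall al, c al != 0 -> (#|supp al| <= M)%N) ->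
      (\sum_al cmod (c al) `^ ((2 * m)%:R / (m + 1)%:R)) `^ ((m + 1)%:R / (2 * m)%:R)
      <= A `^ (M%:R / m%:R) * m%:R `^ ((M%:R ^+ 2 - 1) / (2 * m%:R)).
Proof.
move=> M0; have [A0 A0_ge0 AP] := powR_weight_bound R M0 (leqnn M).
(* With [1 <= A], the exponent of [A] may be enlarged in the last step. *)
pose A := Num.max 1 A0; have A1 : 1 <= A by rewrite le_max lexx.
have A_gt0 : 0 < A by exact: lt_le_trans A1.
exists A => // m n c Mm cP c_deg c_wt; have m0 : (0 < m)%N by exact: leq_trans Mm.
have m1 : 1 <= m%:R :> R by rewrite ler1n.
have mR : 0 < m%:R :> R by rewrite ltr0n.
pose B : R := A * m%:R ^+ M.-1; have B1 : 1 <= B by rewrite mulr_ege1 // exprn_ege1.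
have B_gt0 : 0 < B by exact: lt_le_trans B1.
set p : R := (2 * M)%:R / (M + 1)%:R; set q : R := (2 * m)%:R / (m + 1)%:R.
pose s : R := (M + 1)%:R / (m + 1)%:R.
have nM : (M + 1)%:R != 0 :> R by rewrite pnatr_eq0 addn1.
have nm : (m + 1)%:R != 0 :> R by rewrite pnatr_eq0 addn1.
have p0 : 0 < p by rewrite divr_gt0 // ltr0n ?muln_gt0 ?addn1.
have q0 : 0 < q by rewrite divr_gt0 // ltr0n ?muln_gt0 ?addn1 //= m0.
have s0 : 0 < s by rewrite divr_gt0 // ltr0n ?addn1.
have s1 : s <= 1 by rewrite ler_pdivrMr ?ltr0n ?addn1 // mul1r ler_nat ltnS.
have qE : q = s * p + (1 - s) * 2.
  by rewrite /q /s /p !natrM; field; rewrite -!(natrD _ _ 1) nM nm.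
have Bp : \sum_al cmod (c al) `^ p <= B.
  apply: le_trans (AP _ _ _ m0 cP c_deg c_wt) _.
  by rewrite ler_wpM2r ?exprn_ge0 ?ler0n // le_max lexx orbT.
(* Young's inequality, scaled by [B] so that both sums on the right are at most 1. *)
have young al : cmod (c al) `^ q <=
    B `^ s * (s * (cmod (c al) `^ p / B) + (1 - s) * cmod (c al) ^+ 2).
  have [->|cal] := eqVneq (c al) 0.
    by rewrite cmod0 !powR0 ?lt0r_neq0 // expr0n mul0r !mulr0 addr0 mulr0.
  have c0 : 0 < cmod (c al) by rewrite lt_neqAle eq_sym cmod_eq0 cal cmod_ge0.
  set x := ln (cmod (c al)); have cE : cmod (c al) = expR x by rewrite lnK.
  have BE : B = expR (ln B) by rewrite lnK.
  rewrite cE {1 2}BE -!expRM -expRM_natr -expRN -expRD.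
  set U := x * p - ln B; set V := x * 2.
  set G := s * U + (1 - s) * V.
  (* Tangent line of [expR] at the weighted mean [G] of [U] and [V]: the linear terms cancel in the
     weighted sum. *)
  have tangent y : expR G * (1 + (y - G)) <= expR y.
    rewrite (_ : expR y = expR G * expR (y - G)) ?ler_pM2l ?expR_gt0 ?expR_ge1Dx //.
    by rewrite -expRD addrC subrK.
  have -> : expR (x * q) = expR (ln B * s) * expR G.
    by rewrite -expRD qE /G /U /V; congr expR; ring.
  rewrite ler_pM2l ?expR_gt0 //.
  have := lerD (ler_wpM2l (ltW s0) (tangent U)) (ler_wpM2l (_ : 0 <= 1 - s) (tangent V)).
  rewrite subr_ge0 => /(_ s1); apply: le_trans.
  by rewrite le_eqVlt; apply/orP; left; apply/eqP; rewrite /G; ring.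
have {young Bp} : \sum_al cmod (c al) `^ q <= B `^ s.
  apply: le_trans (ler_sum _ (fun al _ => young al)) _.
  rewrite -mulr_sumr -[leRHS]mulr1 ler_wpM2l ?powR_ge0 // big_split /= -!mulr_sumr -mulr_suml.
  rewrite -[leRHS](subrK s) addrC lerD //.
    by rewrite -[leRHS]mulr1 ler_wpM2l ?subr_ge0 // parseval_le.
  by rewrite -[leRHS]mulr1 ler_wpM2l ?(ltW s0) // ler_pdivrMr // mul1r.
set S := \sum_al _ => SB; have S0 : 0 <= S by apply: sumr_ge0 => al _; exact: powR_ge0.
have e0 : 0 <= (m + 1)%:R / (2 * m)%:R :> R by rewrite divr_ge0 ?ler0n.
apply: (@le_trans _ _ ((B `^ s) `^ ((m + 1)%:R / (2 * m)%:R))).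
  by apply: ge0_ler_powR; rewrite ?nnegrE ?powR_ge0.
have M1 : (M.-1)%:R = M%:R - 1 :> R by rewrite -(prednK M0) -natr1 addrK.
rewrite -powRrM powRM ?exprn_ge0 ?ler0n ?(ltW A_gt0) // -powR_mulrn ?ler0n // -powRrM.
rewrite (_ : _ * (s * _) = (M%:R ^+ 2 - 1) / (2 * m%:R)); last first.
  by rewrite M1 /s !natrM; field; rewrite -?(natrD _ _ 1) nm lt0r_neq0.
(* It remains that [(M + 1) / (2m) <= M / m], which follows from [1 <= M]. *)
rewrite ler_wpM2r ?powR_ge0 // ler_powR // /s.
rewrite mulrA divfK // ler_pdivrMr ?ltr0n ?muln_gt0 ?m0 // mulrAC ler_pdivlMr //.
by rewrite -!natrM ler_nat mulnA leq_mul // addn1 muln2 -addnn -addn1 leq_add2l.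
Qed.

(** * Multivariate polynomials *)

Section Bridge.
Variables (R : realType) (m n : nat) (P : mpoly n R[i]).
Local Notation mon := {ffun 'I_n -> 'I_m.+1}.

Definition mnm_of (al : mon) : multinom n := Multinom [tuple (al j : nat) | j < n].

Lemma mnm_ofE al j : mnm_of al j = al j.
Proof. by rewrite /fun_of_multinom tnth_mktuple. Qed.

Lemma mnm_of_inj : injective mnm_of.
Proof.
by move=> al be /mnmP ab; apply/ffunP => j; apply: val_inj; rewrite /= -!mnm_ofE ab.
Qed.

Lemma mdeg_mnm_of al : mdeg (mnm_of al) = degree al.
Proof. by rewrite mdegE; apply: eq_bigr => j _; rewrite mnm_ofE. Qed.

Lemma mweight_mnm_of al : Defs.mweight (mnm_of al) = #|supp al|.
Proof. by apply: eq_card => j; rewrite !inE mnm_ofE. Qed.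

Hypothesis P_homog : P \is ishomog1 m mdeg.

(** By homogeneity the exponents in [P] are at most [m], so [mnm_of] reaches the whole support. *)
Lemma sum_msupp (V : nmodType) (F : multinom n -> V) :
  (forall a, a \notin msupp P -> F a = 0) ->
  \sum_(a <- msupp P) F a = \sum_(al : mon) F (mnm_of al).
Proof.
move=> F0; rewrite -(big_map mnm_of predT F).
rewrite [RHS](bigID (fun a => a \in msupp P)) /= [X in _ + X]big1 ?addr0 => [|a /F0 //].
rewrite -[RHS]big_filter; apply: perm_big; apply: uniq_perm.
- exact: msupp_uniq.
- by rewrite filter_uniq // map_inj_uniq ?index_enum_uniq //; exact: mnm_of_inj.
move=> a; rewrite mem_filter; case aP : (a \in msupp P) => //=; apply/esym/mapP.
have am : mdeg a = m by exact: (dhomogP _ _ _ P_homog).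
exists [ffun j => inord (a j)]; first exact: mem_index_enum.
apply/mnmP => j; rewrite mnm_ofE ffunE inordK // ltnS -am mdegE (bigD1 j) //=.
exact: leq_addr.
Qed.

Definition coefs (al : mon) : R[i] := mcoeff (mnm_of al) P.

Lemma meval_coefs z : meval z P = peval coefs z.
Proof.
rewrite mevalE sum_msupp => [|a /memN_msupp_eq0 ->]; last by rewrite mul0r.
by apply: eq_bigr => al _; congr (_ * _); apply: eq_bigr => j _; rewrite mnm_ofE.
Qed.

Lemma degree_coefs al : coefs al != 0 -> degree al = m.
Proof. by rewrite -mcoeff_msupp -mdeg_mnm_of => /(dhomogP _ _ _ P_homog). Qed.

Lemma meval_scale (r : R) z : meval (fun j => r%:C%C * z j) P = (r ^+ m)%:C%C * meval z P.
Proof.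
rewrite !meval_coefs mulr_sumr; apply: eq_bigr => al _.
have [->|/degree_coefs alm] := eqVneq (coefs al) 0; first by rewrite !mul0r mulr0.
rewrite mulrCA; congr (_ * _); rewrite /monom; under eq_bigr do rewrite exprMn.
by rewrite big_split /= prodrXr -/(degree al) alm rmorphXn.
Qed.

Lemma cmod_meval_le z : polydisc z -> cmod (meval z P) <= mnorm_oo P.
Proof.
move=> z1; apply: ub_le_sup; last by exists z.
exists (\sum_al cmod (coefs al)) => _ [w w1 <-]; rewrite meval_coefs.
apply: le_trans (cmod_sum _ _ _) _; apply: ler_sum => al _.
rewrite cmodM ler_piMr ?cmod_ge0 // cmod_prod; apply: prodr_ile1 => j.
by rewrite cmodX exprn_ge0 ?cmod_ge0 //= exprn_ile1 ?cmod_ge0 // ltW.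
Qed.

Lemma mnorm_oo_ge0 : 0 <= mnorm_oo P.
Proof.
apply: le_trans (cmod_ge0 _) (cmod_meval_le (z := fun=> 0) _) => j.
by rewrite cmod0 ltr01.
Qed.

(** Shrinking [z] by [1 - d] moves it into the open polydisc and, by homogeneity, multiplies the
    value by [(1 - d) ^+ m]. *)
Lemma cmod_meval_closed z : (forall j, cmod (z j) <= 1) -> cmod (meval z P) <= mnorm_oo P.
Proof.
move=> z1; set X := cmod _; set S := mnorm_oo P; rewrite leNgt; apply/negP => SX.
have S0 : 0 <= S by exact: mnorm_oo_ge0.
have X0 : 0 < X by exact: le_lt_trans SX.
(* This gives [m * d * X < X - S], so Bernoulli's inequality yields [S < (1 - d) ^+ m * X]. *)
pose d := (X - S) / (2 * m.+1%:R * X).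
have mX : 0 < 2 * m.+1%:R * X by rewrite !mulr_gt0 // ltr0n.
have d0 : 0 < d by rewrite divr_gt0 // subr_gt0.
have dE : d * (2 * m.+1%:R * X) = X - S by rewrite divfK // lt0r_neq0.
have d1 : d < 1.
  rewrite ltr_pdivrMr // mul1r; apply: (@le_lt_trans _ _ X); first by rewrite gerBl.
  by rewrite -[ltLHS]mul1r ltr_pM2r // -natrM ltr1n; lia.
have bernoulli k : 1 - k%:R * d <= (1 - d) ^+ k.
  elim: k => [|k IH]; first by rewrite mul0r subr0 expr0.
  rewrite exprS; apply: le_trans (ler_wpM2l _ IH); last by rewrite subr_ge0 ltW.
  rewrite -subr_ge0 -natr1 [X in 0 <= X](_ : _ = k%:R * d ^+ 2); last by ring.
  by rewrite mulr_ge0 ?ler0n ?sqr_ge0.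
have : (1 - d) ^+ m * X <= S.
  rewrite -[X in X * _]ger0_norm ?exprn_ge0 ?subr_ge0 ?(ltW d1) // -cmodC -cmodM -meval_scale.
  apply: cmod_meval_le => j; rewrite cmodM cmodC ger0_norm ?subr_ge0 ?(ltW d1) //.
  apply: (@le_lt_trans _ _ (1 - d)); last by rewrite ltrBlDr ltrDl.
  by rewrite ler_piMr ?subr_ge0 ?(ltW d1).
apply/negP; rewrite -ltNge; apply: lt_le_trans (ler_wpM2r (ltW X0) (bernoulli m)).
rewrite mulrBl mul1r ltrBrDl -ltrBrDr -dE mulrAC mulrC ltr_pM2l // ltr_pM2r //.
by rewrite -natrM ltr_nat; lia.
Qed.

Lemma coef_norm_coefs : (0 < m)%N ->
  coef_norm m P = (\sum_al cmod (coefs al) `^ ((2 * m)%:R / (m + 1)%:R)) `^ ((m + 1)%:R / (2 * m)%:R).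
Proof.
move=> m0; rewrite /coef_norm; congr (_ `^ _); apply: sum_msupp => a /memN_msupp_eq0 ->.
by rewrite cmod0 powR0 // mulf_neq0 ?invr_eq0 // pnatr_eq0 ?addn1 // muln_eq0 -lt0n.
Qed.
End Bridge.

(** * The constants *)

Local Open Scope classical_set_scope.

Lemma BH_bound_of_ball1 (R : realType) (m M : nat) (C : R) : (0 < m)%N -> 0 < C ->
  (forall (n : nat) (c : {ffun 'I_n -> 'I_m.+1} -> R[i]), ball1 c ->
      (forall al, c al != 0 -> degree al = m) ->
      (forall al, c al != 0 -> (#|supp al| <= M)%N) ->
      (\sum_al cmod (c al) `^ ((2 * m)%:R / (m + 1)%:R)) `^ ((m + 1)%:R / (2 * m)%:R) <= C) ->
  BH_bound m M C.
Proof.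
move=> m0 C0 HC n _ P [P_homog P_wt].
(* The slack [e] keeps the normalising factor [D] positive even if the norm is 0. *)
apply/ler_addgt0Pr => e e0; set D := mnorm_oo P + e / C.
have D0 : 0 < D by rewrite ltr_wpDl ?divr_gt0 //; exact: mnorm_oo_ge0 P_homog.
have -> : C * mnorm_oo P + e = C * D by rewrite mulrDr [C * (e / C)]mulrC divfK ?lt0r_neq0.
pose c (al : {ffun 'I_n -> 'I_m.+1}) := (D^-1)%:C%C * coefs P al : R[i].
have c_neq0 al : c al != 0 -> coefs P al != 0.
  by apply: contraNN => /eqP c0; rewrite /c c0 mulr0.
have cE al : cmod (c al) = D^-1 * cmod (coefs P al).
  by rewrite cmodM cmodC ger0_norm // invr_ge0 ltW.
have : (\sum_al cmod (c al) `^ ((2 * m)%:R / (m + 1)%:R)) `^ ((m + 1)%:R / (2 * m)%:R) <= C.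
  apply: HC => [z z1|al /c_neq0|al /c_neq0 cal].
  - rewrite (_ : peval c z = (D^-1)%:C%C * meval z P); last first.
      by rewrite (meval_coefs P_homog) mulr_sumr; apply: eq_bigr => al _; rewrite /c mulrA.
    rewrite cmodM cmodC ger0_norm ?invr_ge0 ?(ltW D0) // mulrC ler_pdivrMr // mul1r.
    by apply: le_trans (cmod_meval_closed P_homog z1) _; rewrite lerDl divr_ge0 // ltW.
  - exact: degree_coefs.
  - rewrite leqNgt; apply: contraNN cal => alM; apply/eqP; apply: P_wt.
    by rewrite mweight_mnm_of.
under eq_bigr do rewrite cE powRM ?cmod_ge0 ?invr_ge0 ?(ltW D0) //.
rewrite -mulr_sumr powRM ?powR_ge0 //; last by apply: sumr_ge0 => al _; exact: powR_ge0.
rewrite -powRrM (_ : _ / _ * (_ / _) = 1); last first.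
  by rewrite mulrA divfK ?divff // pnatr_eq0 ?addn1 // muln_eq0 -lt0n.
rewrite powRr1 ?invr_ge0 ?(ltW D0) // -(coef_norm_coefs P_homog m0).
by rewrite mulrC ler_pdivrMr.
Qed.

(** Tested on [z ^ m] in one variable: its only coefficient is 1, its norm is at most 1, and its
    weight is at most [1 <= M]. *)
Lemma BHconst_ge1 (R : realType) (m M : nat) : (0 < M)%N -> (0 < m)%N ->
  (1%:E <= BHconst R m M)%E.
Proof.
move=> M0 m0; apply/ereal_infP => _ [C HC <-]; rewrite lee_fin.
pose a : multinom 1 := Multinom [tuple m | j < 1].
have aE j : a j = m by rewrite /fun_of_multinom tnth_mktuple.
pose P := mpolyX R[i] a.
have PE z : meval z P = z ord0 ^+ m.
  by rewrite mevalE msuppX big_seq1 mcoeffX eqxx mul1r big_ord1 aE.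
have a_deg : mdeg a = m by rewrite mdegE big_ord1 aE.
have P_homog : P \is ishomog1 m mdeg.
  by apply/dhomogP => b; rewrite msuppX inE => /eqP ->.
have P1 : mnorm_oo P <= 1.
  apply: ge_sup => [|_ [z z1 <-]].
    by exists (cmod (meval (fun=> 0) P)); exists (fun=> 0) => // j; rewrite cmod0 ltr01.
  by rewrite PE cmodX exprn_ile1 ?cmod_ge0 // ltW.
have : coef_norm m P <= C * mnorm_oo P.
  apply: HC => //; split => // b Mb; rewrite mcoeffX; case: eqP => // ab.
  by have := leq_trans Mb (max_card _); rewrite card_ord ltnS leqNgt M0.
rewrite /coef_norm msuppX big_seq1 mcoeffX eqxx cmod1 !powR1 => C1.
have P0 : 0 <= mnorm_oo P by exact: mnorm_oo_ge0 P_homog.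
rewrite leNgt; apply/negP => C_lt1; move: C1; apply/negP; rewrite -ltNge.
have [C0|/ltW C0] := leP 0 C; last by apply: le_lt_trans (mulr_le0_ge0 C0 P0) _.
by apply: le_lt_trans (ler_piMr C0 P1) C_lt1.
Qed.

(** For [m >= 1] the logarithm lies between 0 and [L / sqrt m], because [ln m <= 2 sqrt m]. *)
Lemma cvg_bound (R : realType) (A K : R) (M : nat) : 1 <= A -> 0 <= K ->
  A `^ (M%:R / m%:R) * m%:R `^ (K / (2 * m%:R)) @[m --> \oo] --> (1 : R).
Proof.
move=> A1 K0; pose L := ln A * M%:R + K.
have cvgs : Num.sqrt (m%:R^-1) @[m --> \oo] --> (0 : R).
  rewrite -(sqrtr0 R); apply: (@continuous_cvg _ _ _ _ _ _ _ _ (@sqrt_continuous R 0)).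
  by rewrite -cvg_shiftS; exact: cvg_harmonic.
have cvgE : expR (L * Num.sqrt (m%:R^-1)) @[m --> \oo] --> expR (L * 0).
  apply: (@continuous_cvg _ _ _ _ _ _ _ _ (@continuous_expR R _)).
  exact: cvgMl_tmp.
rewrite mulr0 expR0 in cvgE.
apply: (squeeze_cvgr _ (cvg_cst (1 : R)) cvgE).
near=> m; have m0 : (0 < m)%N by near: m; exists 1%N.
have mR : 0 < m%:R :> R by rewrite ltr0n.
have m1 : 1 <= m%:R :> R by rewrite ler1n.
set r := Num.sqrt _; have rE : r ^+ 2 = m%:R^-1 by rewrite sqr_sqrtr // invr_ge0 ler0n.
have r0 : 0 < r by rewrite sqrtr_gt0 invr_gt0.
have r1 : r <= 1 by rewrite -[leRHS]sqrtr1 ler_wsqrtr // invf_le1.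
have lnA : 0 <= ln A by exact: ln_ge0.
have powE (x y : R) : 0 < x -> x `^ y = expR (y * ln x).
  by move=> x0; rewrite /powR gt_eqF.
rewrite !powE ?(lt_le_trans ltr01 A1) // -expRD -[X in X <= _]expR0 !ler_expR.
have lnm : 0 <= ln (m%:R : R) by exact: ln_ge0.
have lnm_le : ln (m%:R : R) * r ^+ 2 <= 2 * r.
  rewrite -[X in ln X]invrK -rE lnV ?posrE ?exprn_gt0 // lnXn //.
  (* With [r = 1 / sqrt m] this reads [1 + ln m / 2 <= sqrt m]. *)
  have := expR_ge1Dx (- ln r); rewrite expRN lnK // => H.
  rewrite -(ler_pM2r r0) mulVf ?lt0r_neq0 // mulrDl mul1r in H.
  rewrite [leLHS](_ : _ = 2 * r * (- ln r * r)); last by ring.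
  rewrite -[leRHS]mulr1 ler_wpM2l ?mulr_ge0 ?(ltW r0) // (le_trans _ H) // lerDr.
  exact: ltW.
rewrite invfM -rE; apply/andP; split.
  by apply: addr_ge0; rewrite !mulr_ge0 ?ler0n ?(ltW r0) ?invr_ge0 ?ler0n.
rewrite /L mulrDl; apply: lerD.
  rewrite [leLHS](_ : _ = ln A * M%:R * (r * r)); last by ring.
  by rewrite ler_wpM2l ?mulr_ge0 ?ler0n // ler_piMr // ltW.
rewrite [leLHS](_ : _ = K * (2^-1 * (ln m%:R * r ^+ 2))); last by ring.
by rewrite ler_wpM2l // mulrC ler_pdivrMr // [leRHS]mulrC.
Unshelve. all: by end_near.
Qed.

Theorem theorem1 (R : realType) :
  (forall M : nat, (0 < M)%N ->
     exists A : R, 1 <= A /\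
       forall m : nat, (M <= m)%N ->
         (1%:E <= BHconst R m M)%E /\
         (BHconst R m M <=
            (A `^ (M%:R / m%:R)
             * m%:R `^ ((M%:R ^+ 2 - 1) / (2 * m%:R)))%:E)%E) /\
  (forall M : nat, (0 < M)%N ->
     BHconst R m M @[m --> \oo] --> 1%:E).
Proof.
have bounds (M : nat) : (0 < M)%N ->
     exists A : R, 1 <= A /\
       forall m : nat, (M <= m)%N ->
         (1%:E <= BHconst R m M)%E /\
         (BHconst R m M <=
            (A `^ (M%:R / m%:R)
             * m%:R `^ ((M%:R ^+ 2 - 1) / (2 * m%:R)))%:E)%E.
  move=> M0; have [A A1 HA] := BH_ball1 R M0; exists A; split => // m Mm.
  have m0 : (0 < m)%N by exact: leq_trans Mm.
  split; first exact: BHconst_ge1.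
  apply: ereal_inf_lbound; exists (A `^ (M%:R / m%:R) * m%:R `^ ((M%:R ^+ 2 - 1) / (2 * m%:R))) => //.
  apply: BH_bound_of_ball1 => // [|n c]; last exact: HA.
  by rewrite mulr_gt0 // powR_gt0 ?ltr0n // (lt_le_trans ltr01).
split=> // M M0; have [A [A1 HA]] := bounds M M0.
have K0 : 0 <= M%:R ^+ 2 - 1 :> R by rewrite subr_ge0 exprn_ege1 // ler1n.
have bound_cvg := cvg_bound M A1 K0.
apply: (@squeeze_cvge _ _ _ _ (cst 1%:E) _
  (fun m : nat => (A `^ (M%:R / m%:R) * m%:R `^ ((M%:R ^+ 2 - 1) / (2 * m%:R)))%:E)).
- near=> m; have Mm : (M <= m)%N by near: m; exists M.
  by apply/andP; exact: HA.
- exact: cvg_cst.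
- by apply: cvg_EFin => //; near=> m.
Unshelve. all: by end_near.
Qed.
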